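(* The min-max static regret of any online algorithm (under adversarial input) is $\Omega(T)$. That is, there exist a decision set $\mathcal X$ and constants $D,B,G>0$ as in the context, and a constant $c>0$, such that for every online algorithm $\mathcal A$ and all sufficiently large horizons $T$, $R_{\mathcal A}(T)\ge cT$, where $$R_{\mathcal A}(T)=\sup_{(f_t,g_t)_{t=1}^T}\{C_{\mathcal A}-C_{\mathsf{OPT}}\}$$ and the supremum is over all sequences of loss pairs admissible in the sense of the context.
   Context: Setting. $\mathcal X\subset\mathbb R^d$ is closed and convex with finite Euclidean diameter $D$. A loss pair $(f_t,g_t)$ is admissible if $f_t,g_t:\mathcal X\to\mathbb R$ are convex, satisfy $|f_t(x)|\le B$ and $|g_t(x)|\le B$ for all $x\in\mathcal X$, and are $G$-Lipschitz on $\mathcal X$ (Euclidean norm). In each round $t=1,\dots,T$ the online algorithm $\mathcal A$ first chooses an action $x_t\in\mathcal X$, then the adversary chooses an admissible pair $(f_t,g_t)$, and $f_t(x_t),\nabla f_t(x_t),g_t(x_t),\nabla g_t(x_t)$ are revealed to the algorithm. Costs. $C_{\mathcal A}=\max\{\sum_{t=1}^T f_t(x_t),\ \sum_{t=1}^T g_t(x_t)\}$, where $x_1,\dots,x_T$ are the actions of $\mathcal A$, and $C_{\mathsf{OPT}}=\min_{x\in\mathcal X}\max\{\sum_{t=1}^T f_t(x),\ \sum_{t=1}^T g_t(x)\}$ is the cost of the best static action in hindsight. *)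

(* Defs.v *)
(* MathComp-Analysis, over an abstract R : realType. *)
From HB Require Import structures.
From mathcomp Require Import all_boot all_order all_algebra.
From mathcomp Require Import all_classical all_reals all_analysis.

Set Implicit Arguments.
Unset Strict Implicit.
Unset Printing Implicit Defensive.

Import Order.TTheory GRing.Theory Num.Theory.
Import numFieldNormedType.Exports.

Local Open Scope classical_set_scope.
Local Open Scope ring_scope.

Section OnlineLearning.
Context {R : realType} {d : nat}.

Local Notation V := 'rV[R]_d.

Definition dot (u v : V) : R := \sum_(i < d) u 0 i * v 0 i.

(* The norm that the library puts on row vectors is the sup norm, hence this
   definition; both norms induce the library's topology on 'rV[R]_d. *)
Definition enorm (u : V) : R := Num.sqrt (dot u u).

Definition distances (X : set V) : set R :=
  [set enorm (p.1 - p.2) | p in X `*` X].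

(* has_sup makes X nonempty and its diameter finite. *)
Definition has_diameter (X : set V) (D : R) : Prop :=
  has_sup (distances X) /\ sup (distances X) = D.

(* Losses are total functions, but only their restriction to X is constrained
   by the admissibility conditions. *)
Definition loss := V -> R.

Definition loss_pair := (loss * loss)%type.

Definition admissible_loss (X : set V) (B G : R) (f : loss) : Prop :=
  [/\ convex_function X f,
      forall x, X x -> `|f x| <= B
    & forall x y, X x -> X y -> `|f x - f y| <= G * enorm (x - y)].

Definition admissible (X : set V) (B G : R) (l : loss_pair) : Prop :=
  admissible_loss X B G l.1 /\ admissible_loss X B G l.2.

Definition subgradient (X : set V) (f : loss) (x v : V) : Prop :=
  forall y, X y -> f x + dot v (y - x) <= f y.

(* Convex losses need not be differentiable: grad f x stands for any choice of
   a subgradient of f at x. It is unconstrained where no subgradient exists,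
   so such operators exist for every X. *)
Definition gradient_operator (X : set V) (grad : loss -> V -> V) : Prop :=
  forall f x, X x -> (exists v, subgradient X f x v) ->
    subgradient X f x (grad f x).

(* What is revealed after a round: f_t(x_t), grad f_t(x_t), g_t(x_t) and
   grad g_t(x_t). *)
Definition feedback := (R * V * R * V)%type.

Definition reveal (grad : loss -> V -> V) (l : loss_pair) (x : V) : feedback :=
  (l.1 x, grad l.1 x, l.2 x, grad l.2 x).

(* A deterministic algorithm maps the horizon and the feedback of the past
   rounds, in chronological order, to the next action; past actions are
   determined by these data. *)
Definition algorithm := nat -> seq feedback -> V.

Definition online_algorithm (X : set V) (A : algorithm) : Prop :=
  forall T h, X (A T h).

Section Run.
Variables (grad : loss -> V -> V) (A : algorithm) (T : nat).
(* Rounds are numbered from 0: rounds t < T are those of the horizon T. *)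
Variable l : nat -> loss_pair.

(* The feedback of the rounds s < t. *)
Fixpoint history (t : nat) : seq feedback :=
  if t is s.+1 then
    let h := history s in rcons h (reveal grad (l s) (A T h))
  else [::].

Definition action (t : nat) : V := A T (history t).

Definition algorithm_cost : R :=
  Num.max (\sum_(t < T) (l t).1 (action t)) (\sum_(t < T) (l t).2 (action t)).

End Run.

Definition static_cost (T : nat) (l : nat -> loss_pair) (x : V) : R :=
  Num.max (\sum_(t < T) (l t).1 x) (\sum_(t < T) (l t).2 x).

(* For X nonempty, closed and bounded and admissible losses, this infimum is
   attained: static_cost is continuous on the compact set X. *)
Definition opt_cost (X : set V) (T : nat) (l : nat -> loss_pair) : R :=
  inf [set static_cost T l x | x in X].

Definition admissible_sequence (X : set V) (B G : R) (T : nat)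
    (l : nat -> loss_pair) : Prop :=
  forall t, (t < T)%N -> admissible X B G (l t).

Definition regret (X : set V) (B G : R) (grad : loss -> V -> V)
    (A : algorithm) (T : nat) : \bar R :=
  ereal_sup [set (algorithm_cost grad A T l - opt_cost X T l)%:E |
             l in admissible_sequence X B G T].

End OnlineLearning.

Arguments loss R d : clear implicits.
Arguments algorithm R d : clear implicits.

(* Main.v *)
(** In the first half of the horizon the losses on the segment [0, 1] are the
    antagonistic pair [f(x) = x], [g(x) = 1 - x]; in the second half they are
    constant, equal to either [(1, 0)] or [(0, 1)]. The algorithm has to fix the
    sum [S] of its first-half actions before it learns which of the two second
    halves occurs, and its regret is at least [S] in one case (against [x = 0])
    and [T/2 - S] in the other (against [x = 1]). *)
Require Import Defs.
From HB Require Import structures.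
From mathcomp Require Import all_boot all_order all_algebra.
From mathcomp Require Import all_classical all_reals all_analysis.
From mathcomp Require Import zify ring lra.

Set Implicit Arguments.
Unset Strict Implicit.
Unset Printing Implicit Defensive.

Import Order.TTheory GRing.Theory Num.Theory.
Import numFieldNormedType.Exports.

Local Open Scope classical_set_scope.
Local Open Scope ring_scope.

(** Causality: while the first phase lasts, the algorithm cannot tell which second phase will
    follow, so its first-phase play is common to all continuations. *)
Lemma eq_history (R : realType) (d : nat) (grad : loss R d -> 'rV[R]_d -> 'rV[R]_d)
    (A : algorithm R d) (T : nat) (l l' : nat -> loss_pair) (t : nat) :
  (forall s, (s < t)%N -> l s = l' s) ->
  history grad A T l t = history grad A T l' t.
Proof.
elim: t => //= t IH ll'.
by rewrite ll'// IH// => s st; apply: ll'; exact: ltnW.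
Qed.

Section Segment.
Variable R : realType.
Implicit Types (a b u v : R) (x y : 'rV[R]_1).

Definition segment : set 'rV[R]_1 := [set x | 0 <= x 0 0 <= 1].

Lemma closed_segment : closed segment.
Proof.
rewrite (_ : segment = (fun x => x 0 0) @^-1` `[0, 1]%classic); last first.
  by apply/seteqP; split => x /=; rewrite in_itv.
by apply: preimage_closed => [x _|]; [exact: coord_continuous|exact: itv_closed].
Qed.

Lemma convex_segment : convex_set segment.
Proof.
move=> x y t; rewrite !inE /segment /= => /andP[x0 x1] /andP[y0 y1].
have t0 : 0 <= t%:num by [].
have t1 : t%:num <= 1 by [].
rewrite /conv /= !mxE /unstable.onem.
by apply/andP; split; nra.
Qed.

Lemma enorm1 x : enorm x = `|x 0 0|.
Proof. by rewrite /enorm /dot big_ord1 -expr2 sqrtr_sqr. Qed.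

Lemma const_segment a : 0 <= a <= 1 -> segment (const_mx a).
Proof. by rewrite /segment /= mxE. Qed.

Lemma diameter_segment : has_diameter segment 1.
Proof.
have ub : ubound (distances segment) 1.
  move=> _ [[x y] /= [/andP[x0 x1] /andP[y0 y1]] <-].
  by rewrite enorm1 !mxE ler_norml; lra.
have d1 : distances segment 1.
  exists (const_mx 1, const_mx 0); last by rewrite enorm1 !mxE subr0 normr1.
  by split; apply: const_segment; rewrite ?lexx ?ler01.
have ne : distances segment !=set0 by exists 1.
split; first by split=> //; exists 1.
apply/eqP; rewrite eq_le ge_sup//=.
by apply: ub_le_sup => //; exists 1.
Qed.

Definition affine a b : loss R 1 := fun x => a * x 0 0 + b.

(** The values at the endpoints of the segment are [b] and [a + b], so the values in between stay in
    [0, 1]; the slope is the Lipschitz constant. *)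
Lemma admissible_affine a b : `|a| <= 1 -> 0 <= b <= 1 -> 0 <= a + b <= 1 ->
  admissible_loss segment 1 1 (affine a b).
Proof.
move=> a1 /andP[b0 b1] /andP[ab0 ab1]; split.
- move=> t x y _ _; rewrite /affine convRE.
  rewrite [conv t x y]/conv /= !mxE /unstable.onem.
  by rewrite le_eqVlt; apply/orP; left; apply/eqP; ring.
- move=> x /andP[x0 x1]; rewrite /affine ler_norml; apply/andP; split; nra.
- move=> x y _ _; rewrite enorm1 /affine !mxE.
  rewrite (_ : _ - _ = a * (x 0 0 - y 0 0)); last by ring.
  by rewrite normrM ler_wpM2r.
Qed.

Definition two_phase (n : nat) u v (t : nat) : loss_pair :=
  if (t < n)%N then (affine 1 0, affine (-1) 1) else (affine 0 u, affine 0 v).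

Lemma admissible_two_phase n T u v : 0 <= u <= 1 -> 0 <= v <= 1 ->
  admissible_sequence segment 1 1 T (two_phase n u v).
Proof.
move=> u01 v01 t _; rewrite /two_phase.
case: ifP => _; split; apply: admissible_affine;
  by rewrite ?normr0 ?normrN ?normr1 ?add0r ?addr0 ?addNr ?lexx ?ler01.
Qed.

Lemma sum_two_phase n T (F : nat -> R) (c : R) : (n <= T)%N ->
  (forall t, (n <= t)%N -> F t = c) ->
  \sum_(t < T) F t = \sum_(t < n) F t + c * (T - n)%:R.
Proof.
move=> nT Fc; rewrite -(big_mkord xpredT F) (big_cat_nat (leq0n n) nT)//= big_mkord.
congr (_ + _); rewrite (eq_big_nat _ _ (F2 := fun=> c)).
  by rewrite sumr_const_nat mulr_natr.
by move=> t /andP[nt _]; exact: Fc.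
Qed.

(** The points [z t] are arbitrary, so that the formula serves both the actions of the algorithm and
    a static comparator. *)
Lemma two_phase_costE n T u v (z : nat -> 'rV[R]_1) : (n <= T)%N ->
  Num.max (\sum_(t < T) (two_phase n u v t).1 (z t))
          (\sum_(t < T) (two_phase n u v t).2 (z t)) =
  Num.max (\sum_(t < n) z t 0 0 + u * (T - n)%:R)
          (n%:R - \sum_(t < n) z t 0 0 + v * (T - n)%:R).
Proof.
move=> nT; congr Num.max.
- rewrite (sum_two_phase (F := fun t => (two_phase n u v t).1 (z t)) (c := u) nT).
    congr (_ + _); apply: eq_bigr => t _.
    by rewrite /two_phase ltn_ord/= /affine mul1r addr0.
  by move=> t nt; rewrite /two_phase ltnNge nt/= /affine mul0r add0r.
- rewrite (sum_two_phase (F := fun t => (two_phase n u v t).2 (z t)) (c := v) nT).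
    congr (_ + _); rewrite -[n in n%:R]card_ord -sumr_const -sumrB.
    apply: eq_bigr => t _.
    by rewrite /two_phase ltn_ord/= /affine mulN1r addrC.
  by move=> t nt; rewrite /two_phase ltnNge nt/= /affine mul0r add0r.
Qed.

Lemma static_cost_two_phase n T u v x : (n <= T)%N ->
  static_cost T (two_phase n u v) x =
  Num.max (n%:R * x 0 0 + u * (T - n)%:R)
          (n%:R - n%:R * x 0 0 + v * (T - n)%:R).
Proof.
move=> nT; rewrite /static_cost (two_phase_costE u v (fun=> x) nT).
by rewrite sumr_const card_ord mulr_natl.
Qed.

Lemma opt_cost_two_phase n T u v x : (n <= T)%N -> 0 <= u -> segment x ->
  opt_cost segment T (two_phase n u v) <=
  Num.max (n%:R * x 0 0 + u * (T - n)%:R)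
          (n%:R - n%:R * x 0 0 + v * (T - n)%:R).
Proof.
move=> nT u0 sx; rewrite -static_cost_two_phase//.
apply: ge_inf; last by exists x.
(* An infimum bounds its elements from below only for a set that is bounded below; here 0 is a
   bound, because the first component of each cost is nonnegative. *)
exists 0 => _ [y /andP[y0 _] <-]; rewrite static_cost_two_phase// le_max.
by rewrite addr_ge0// mulr_ge0.
Qed.

Section Regret.
Variables (grad : loss R 1 -> 'rV[R]_1 -> 'rV[R]_1) (A : algorithm R 1).

(* The constants [0 0] are immaterial: the actions up to round [n] depend only
   on the losses before round [n]. *)
Definition first_phase_sum (T n : nat) : R :=
  \sum_(t < n) action grad A T (two_phase n 0 0) t 0 0.

Lemma algorithm_cost_two_phase n T u v : (n <= T)%N ->
  algorithm_cost grad A T (two_phase n u v) =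
  Num.max (first_phase_sum T n + u * (T - n)%:R)
          (n%:R - first_phase_sum T n + v * (T - n)%:R).
Proof.
move=> nT; rewrite /algorithm_cost two_phase_costE//.
suff -> : \sum_(t < n) action grad A T (two_phase n u v) t 0 0 =
    first_phase_sum T n by [].
apply: eq_bigr => t _; rewrite /action (@eq_history _ _ _ _ _ _ (two_phase n 0 0))//.
by move=> s st; rewrite /two_phase (ltn_trans st).
Qed.

(** The optimum need not be computed: a single comparator [x] bounds it from above, which is the
    direction that a lower bound on the regret requires. *)
Lemma regret_two_phase n T u v x (c : R) : (n <= T)%N ->
  0 <= u <= 1 -> 0 <= v <= 1 -> segment x ->
  c + Num.max (n%:R * x 0 0 + u * (T - n)%:R)
              (n%:R - n%:R * x 0 0 + v * (T - n)%:R) <=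
    Num.max (first_phase_sum T n + u * (T - n)%:R)
            (n%:R - first_phase_sum T n + v * (T - n)%:R) ->
  (c%:E <= regret segment 1 1 grad A T)%E.
Proof.
move=> nT u01 v01 sx cle; apply: le_ereal_sup_tmp.
exists (algorithm_cost grad A T (two_phase n u v) -
        opt_cost segment T (two_phase n u v))%:E.
  by exists (two_phase n u v) => //; exact: admissible_two_phase.
rewrite lee_fin lerBrDr algorithm_cost_two_phase//.
apply: le_trans cle; rewrite lerD2l; apply: opt_cost_two_phase => //.
by case/andP: u01.
Qed.

Lemma regret_lower_bound T : (1 < T)%N ->
  ((6^-1 * T%:R)%:E <= regret segment 1 1 grad A T)%E.
Proof.
move=> T1; set n := T./2.
have nT : (n <= T)%N by lia.
(* The second phase is at least as long as the first, so either comparator below pays exactly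
   [T - n]. *)
have nTn : n%:R <= (T - n)%:R :> R by rewrite ler_nat; lia.
(* Since [T > 1] gives [n >= 1], one has [T <= 2n + 1 <= 3n]. An excess of [n / 2] is thus at least
   [T / 6]. *)
have T3n : T%:R <= 3 * n%:R :> R by rewrite -natrM ler_nat; lia.
have [S_large|S_small] := leP (n%:R / 2) (first_phase_sum T n).
(* The first loss of the algorithm totals [S + (T - n)], where [S] is the first-phase sum: an excess
   of [S >= n / 2] over [x = 0]. *)
- apply: (@regret_two_phase n T 1 0 (const_mx 0)) => //.
  + by rewrite ler01 lexx.
  + by rewrite lexx ler01.
  + by apply: const_segment; rewrite lexx ler01.
  + rewrite mxE mulr0 mul0r mul1r !addr0 subr0 add0r (max_idPl nTn) le_max.
    by apply/orP; left; lra.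
(* Symmetrically, the second loss totals [n - S + (T - n)]: an excess of [n - S > n / 2] over
   [x = 1]. *)
- apply: (@regret_two_phase n T 0 1 (const_mx 1)) => //.
  + by rewrite lexx ler01.
  + by rewrite ler01 lexx.
  + by apply: const_segment; rewrite ler01 lexx.
  + rewrite mxE mulr1 mul0r mul1r !addr0 subrr add0r (max_idPr nTn) le_max.
    by apply/orP; right; lra.
Qed.

End Regret.
End Segment.

Theorem theorem4 (R : realType) :
  exists (d : nat) (X : set 'rV[R]_d) (D B G c : R),
    [/\ closed X, convex_set X, has_diameter X D
      & [/\ 0 < D, 0 < B, 0 < G & 0 < c]] /\
    forall grad : loss R d -> 'rV[R]_d -> 'rV[R]_d,
      gradient_operator X grad ->
      forall A : algorithm R d, online_algorithm X A ->
        \forall T \near \oo, ((c * T%:R)%:E <= regret X B G grad A T)%E.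
Proof.
exists 1%N, (@segment R), 1, 1, 1, 6^-1; split.
  split; [exact: closed_segment|exact: convex_segment|exact: diameter_segment|].
  by rewrite ltr01 invr_gt0 ltr0n.
by move=> grad _ A _; exists 2%N => // T /= T2; exact: regret_lower_bound.
Qed.
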